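(* Let $K\subset\mathbb{C}$ be compact and polynomially convex, and let $(q_k)_k$ be a sequence of polynomials with $\deg q_k = n_k\to\infty$. If $(q_k)_k$ centers on $K$, then for every $m=1,2,\ldots$ the sequence of $m$th derivatives $(q_k^{(m)})_k$ also centers on $K$.
   Context: Definition (centering): Let $C\subset\mathbb{C}$ be non-empty and compact and let $(q_k)_k$ be a sequence of polynomials. We say $(q_k)_k$ centers on $C$ if there exist $R>0$ and $k_0$ such that (1) all zeros of $q_k$ lie in the disk $\mathbb{D}(0,R)=\{|z|<R\}$ for all $k\ge k_0$ (in particular $q_k$ is not the zero polynomial for $k\ge k_0$); (2) for every closed $L\subset\mathbb{C}$ with $L\cap C=\emptyset$ there is $M=M(L)$ such that the number of zeros of $q_k$ in $L$, counted with multiplicity, is at most $M$ for all $k\ge k_0$. *)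

(* Defs.v *)
From HB Require Import structures.
From mathcomp Require Import all_boot all_order all_algebra.
From mathcomp Require Import all_classical all_reals all_analysis.
From mathcomp Require Import complex.
Import Order.TTheory GRing.Theory Num.Theory.
Import numFieldNormedType.Exports.
Local Open Scope classical_set_scope.
Local Open Scope ring_scope.
Local Open Scope complex_scope.

(* The complex plane is modelled as R[i] for R : realType, with the
   norm/metric topology induced by the complex modulus. *)
HB.instance Definition _ (R : realType) := PseudoPointedMetric.copy R[i] (R[i])^o.

(* A sequence of roots (with multiplicity) of a polynomial over an
   algebraically closed field: p = lead_coef p *: \prod_(z <- rootsC p) ('X - z). *)
Definition rootsC {R : realType} (p : {poly R[i]}) : seq R[i] :=
  sval (closed_field_poly_normal p).

Definition nzeros_in {R : realType} (L : set R[i]) (p : {poly R[i]}) : nat :=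
  count (fun z => `[< L z >]) (rootsC p).

Definition poly_hull {R : realType} (K : set R[i]) : set R[i] :=
  [set z | forall (p : {poly R[i]}) (M : R),
      (forall w, K w -> `|p.[w]| <= M%:C) -> `|p.[z]| <= M%:C].

Definition poly_convex {R : realType} (K : set R[i]) : Prop :=
  poly_hull K `<=` K.

Definition centers_on {R : realType} (C : set R[i]) (q : nat -> {poly R[i]}) : Prop :=
  exists (Rad : R) (k0 : nat), 0 < Rad /\
    (forall k, (k0 <= k)%N -> q k != 0 /\
        forall z, root (q k) z -> `|z| < Rad%:C) /\
    (forall L : set R[i], closed L -> L `&` C = set0 ->
       exists M : nat, forall k, (k0 <= k)%N -> (nzeros_in L (q k) <= M)%N).

(* Main.v *)
Require Import Defs.
From HB Require Import structures.
From mathcomp Require Import all_boot all_order all_algebra.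
From mathcomp Require Import cyclic separable cyclotomic.
From mathcomp Require Import all_classical all_reals all_analysis.
From mathcomp Require Import complex ring lra.
Set Implicit Arguments.
Unset Strict Implicit.
Unset Printing Implicit Defensive.
Import Order.TTheory GRing.Theory Num.Theory.
Import numFieldNormedType.Exports.
Import ComplexField.Normc.
Local Open Scope classical_set_scope.
Local Open Scope ring_scope.
Local Open Scope complex_scope.

(* Write q = c Q1 Q2 with Q1 = prod_(z in s1) (X - z), let D be a monic factor
   of q' without zero in s1, and let H be a monic multiple of Q2 of degree
   deg D.  The residues of (q'/q) (H/D) add up to
     sum_(z in s1) H(z)/D(z) = deg q,
   so |H| < |D| cannot hold on all of s1.  With D = X - w and H = X this bounds
   the zeros of q'.  To bound the number of zeros of q' near a point w0, let D
   carry many of them, Q2 the boundedly many zeros of q away from K, and take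
   H = G^a Q2 where G is monic and |G(z)| < th |z - w0|^(deg G) on K for some
   th < 1.

   It remains to find such a G for each w0 outside K.  The points that have one
   form an open set, which contains a neighbourhood of infinity and is
   relatively closed in the complement of K.  So its complement A is compact,
   and each point of A outside K is interior to A.  By the maximum principle on
   A, every point of A lies in the polynomial hull of K, which is K. *)

(** * Degrees of derivatives in characteristic zero *)

Lemma size_deriv_num (F : numDomainType) (p : {poly F}) :
  size p^`() = (size p).-1.
Proof.
have [->|p0] := eqVneq p 0; first by rewrite deriv0 size_poly0.
have p1 : (0 < size p)%N by rewrite size_poly_gt0.
apply/eqP; rewrite eqn_leq -ltnS prednK // lt_size_deriv //=.
case E: (size p) => [|[|n]] //=; rewrite ltnNge.
apply/negP => /leq_sizeP /(_ _ (leqnn _)) /eqP.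
rewrite coef_deriv mulrn_eq0 /= -[n.+1]/(n.+2.-1) -E -lead_coefE.
by rewrite lead_coef_eq0 (negPf p0).
Qed.

Lemma size_derivn_num (F : numDomainType) (p : {poly F}) n :
  size p^`(n) = (size p - n)%N.
Proof.
by elim: n => [|n IH]; rewrite ?subn0 // derivnS size_deriv_num IH subnS.
Qed.

(** * The residue identity for a factor of the derivative *)

Definition poly_of_roots {F : nzRingType} (s : seq F) : {poly F} :=
  \prod_(z <- s) ('X - z%:P).

Section ResidueIdentity.
Variable F : numFieldType.
Implicit Types (s t : seq F) (G B : {poly F}).

Lemma size_poly_of_roots s : size (poly_of_roots s) = (size s).+1.
Proof. exact: size_prod_XsubC. Qed.

Lemma monic_poly_of_roots s : poly_of_roots s \is monic.
Proof. exact: monic_prod_XsubC. Qed.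

Lemma poly_of_roots_rem (z : F) s : z \in s ->
  poly_of_roots s = ('X - z%:P) * poly_of_roots (rem z s).
Proof.
by move=> zs; rewrite /poly_of_roots (perm_big _ (perm_to_rem zs)) big_cons.
Qed.

Lemma deriv_poly_of_roots s : (poly_of_roots s)^`() = \sum_(z <- s) poly_of_roots (rem z s).
Proof.
elim: s => [|a s IH]; first by rewrite /poly_of_roots !big_nil -[1]/(1%:P) derivC.
rewrite [poly_of_roots (a :: s)]/poly_of_roots big_cons derivM derivXsubC mul1r big_cons /= eqxx.
congr (_ + _); rewrite -/(poly_of_roots s) IH mulr_sumr !big_seq.
apply: eq_bigr => z zs; case: eqP => [->|_]; first by rewrite -poly_of_roots_rem.
by rewrite /poly_of_roots big_cons.
Qed.

(** With [D], [Q1], [Q2] the polynomials of [t], [s1], [s2], the function [(Q'/Q) (G Q2 / D)] is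
    [G B / Q1], which behaves like [n / X] at infinity. The size condition says that [G * Q2], the H
    of the overview, has the degree of [D]. Entries of [s1] may repeat, so the argument runs modulo
    [Q1] rather than by interpolation at distinct nodes. *)
Lemma residue_sum s1 s2 t G B : (0 < size s1 + size s2)%N ->
  (poly_of_roots (s1 ++ s2))^`() = poly_of_roots t * B ->
  {in s1, forall z, (poly_of_roots t).[z] != 0} ->
  G \is monic -> (size G + size s2 = (size t).+1)%N ->
  \sum_(z <- s1) (G * poly_of_roots s2).[z] / (poly_of_roots t).[z]
    = (size s1 + size s2)%:R.
Proof.
move=> n0 dE tz mG sG.
set D := poly_of_roots t; set Q1 := poly_of_roots s1; set Q2 := poly_of_roots s2.
set n := (_ + _)%N in n0 *.
have Q12 : poly_of_roots (s1 ++ s2) = Q1 * Q2 by rewrite /poly_of_roots big_cat.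
have sQ : size (poly_of_roots (s1 ++ s2)) = n.+1 by rewrite size_poly_of_roots size_cat.
have cd : ((poly_of_roots (s1 ++ s2))^`())`_n.-1 = n%:R.
  rewrite coef_deriv prednK //.
  by have /monicP := monic_poly_of_roots (s1 ++ s2); rewrite lead_coefE sQ /= => ->.
have sd : size (poly_of_roots (s1 ++ s2))^`() = n by rewrite size_deriv_num sQ.
have B0 : B != 0.
  by apply: contraTneq n0 => B0; rewrite -sd dE B0 mulr0 size_poly0.
have lB : lead_coef B = n%:R.
  by rewrite -(lead_coef_monicM _ (monic_poly_of_roots t)) -dE lead_coefE sd cd.
have sB : (size t + size B = n)%N.
  by rewrite -sd dE size_monicM ?monic_poly_of_roots // size_poly_of_roots.
have sGB : size (G * B) = size s1.
  rewrite size_monicM //; apply/eqP.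
  have Gp : (0 < size G)%N by rewrite size_poly_gt0 monic_neq0.
  rewrite -(eqn_add2r (size s2)) -/n -sB -subn1 addnBAC ?subn1; last first.
    by rewrite addn_gt0 Gp.
  by rewrite addnAC sG addSn.
(* [P] is [G * B]: both have degree less than [size s1], and [D * P] and
   [D * (G * B) = G * (Q1 * Q2)'] agree modulo [Q1]. *)
pose c z := (G * Q2).[z] / D.[z].
pose P := \sum_(z <- s1) c z *: poly_of_roots (rem z s1).
have sr z : z \in s1 -> size (poly_of_roots (rem z s1)) = size s1.
  by move=> zs; rewrite size_poly_of_roots size_rem // prednK //; case: (s1) zs.
have sP : (size P <= size s1)%N.
  rewrite /P big_seq; apply: (big_ind (fun p : {poly F} => size p <= size s1)%N).
  - by rewrite size_poly0.
  - by move=> p q hp hq; rewrite (leq_trans (size_polyD _ _)) // geq_max hp hq.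
  - by move=> z zs; rewrite (leq_trans (size_scale_leq _ _)) // sr.
(* Term by term: [c z] makes [c z *: D - G * Q2] vanish at [z], which supplies the factor [X - z]
   missing from [poly_of_roots (rem z s1)]. *)
have dvd1 : Q1 %| D * P - G * Q2 * Q1^`().
  rewrite /P deriv_poly_of_roots !mulr_sumr -sumrB big_seq; apply: (big_ind (fun p => Q1 %| p)).
  - exact: dvdp0.
  - by move=> p q; apply: dvdp_add.
  - move=> z zs; rewrite -scalerAr scalerAl -mulrBl /Q1 (poly_of_roots_rem zs).
    apply: dvdp_mul => //; rewrite dvdp_XsubCl; apply/rootP.
    by rewrite !hornerE /c !hornerE divfK ?subrr // tz.
have dvd2 : Q1 %| D * (P - G * B).
  suff -> : D * (P - G * B) = (D * P - G * Q2 * Q1^`()) - Q1 * (G * Q2^`()).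
    by rewrite dvdp_sub // dvdp_mulr.
  rewrite mulrBr [D * (_ * _)]mulrCA -dE Q12 derivM mulrDr opprD addrA.
  by rewrite [Q1^`() * _]mulrC !mulrA [G * Q1]mulrC.
have cop : coprimep Q1 D.
  rewrite /Q1 /poly_of_roots; rewrite coprimep_sym; rewrite big_seq.
  apply: (big_ind (fun p => coprimep D p)).
  - exact: coprimep1.
  - by move=> p q hp hq; rewrite coprimepMr hp.
  - by move=> z zs; rewrite coprimep_XsubC rootE; apply: tz.
rewrite Gauss_dvdpr // in dvd2.
have /eqP PE : P - G * B == 0.
  apply/contraTT: dvd2 => nz; apply/negP => /(dvdp_leq nz).
  rewrite size_poly_of_roots leqNgt ltnS (leq_trans (size_polyD _ _)) //.
  by rewrite geq_max sP size_polyN sGB leqnn.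
move/eqP: PE; rewrite subr_eq0 => /eqP PE.
(* Each cofactor [poly_of_roots (rem z s1)] is monic of degree [(size s1).-1], so this coefficient
   of [P] is the sum of the [c z]. *)
have lP : P`_(size s1).-1 = n%:R.
  by rewrite PE -sGB -lead_coefE lead_coef_monicM.
rewrite -lP coef_sum !big_seq; apply: eq_bigr => z zs.
rewrite coefZ -(sr _ zs) -lead_coefE; move/monicP: (monic_poly_of_roots (rem z s1)) => ->.
by rewrite mulr1.
Qed.

(** Otherwise every term of the residue sum has modulus below 1, while the [size s1] terms add up to
    [size s1 + size s2]. *)
Lemma deriv_factor_excluded s1 s2 t G :
  (0 < size s1 + size s2)%N ->
  poly_of_roots t %| (poly_of_roots (s1 ++ s2))^`() ->
  G \is monic -> (size G + size s2 = (size t).+1)%N ->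
  ~ {in s1, forall z, `|(G * poly_of_roots s2).[z]| < `|(poly_of_roots t).[z]|}.
Proof.
move=> n0 /dvdpP[B dE] mG sG lt.
have tz : {in s1, forall z, (poly_of_roots t).[z] != 0}.
  by move=> z zs; rewrite -normr_gt0 (le_lt_trans _ (lt z zs)).
have := residue_sum n0 (etrans dE (mulrC _ _)) tz mG sG.
move/(congr1 Num.norm); rewrite normr_nat; apply/eqP; rewrite lt_eqF //.
apply: (le_lt_trans (ler_norm_sum _ _ _)).
have lt1 z : z \in s1 -> `|(G * poly_of_roots s2).[z] / (poly_of_roots t).[z]| < 1.
  by move=> zs; rewrite normf_div ltr_pdivrMr ?mul1r ?normr_gt0 ?tz // lt.
(* For empty [s1] the sum is 0, and [n0] gives the strict inequality. *)
have [s10|s1n] := eqVneq s1 [::]; first by move: n0; rewrite s10 big_nil ltr0n.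
apply: (@lt_le_trans _ _ (size s1)%:R); last by rewrite ler_nat leq_addr.
rewrite -sum1_size natr_sum !big_seq; apply: ltr_sum => //.
by case: (s1) s1n => // a l _; rewrite /= mem_head.
Qed.
End ResidueIdentity.

(** * Topology of the complex plane through the real-valued modulus *)

Lemma continuous_horner_num (K : numFieldType) (p : {poly K}) :
  continuous (horner p : K -> K).
Proof.
elim/poly_ind: p => [|p c IH].
  have -> : horner (0 : {poly K}) = fun=> 0 by apply/funext => z; rewrite horner0.
  exact: cst_continuous.
have -> : horner (p * 'X + c%:P) = (fun z => p.[z] * z + c).
  by apply/funext => z; rewrite hornerMXaddC.
move=> z; apply: (@continuousD K K^o K (fun z => p.[z] * z : K^o)); last exact: cst_continuous.
by apply: (@continuousM K K) => //; exact: IH.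
Qed.

Section ComplexModulus.
Variable R : realType.
Implicit Types z w : R[i].

Lemma normr_normc z : `|z| = (normc z)%:C. Proof. by case: z. Qed.
Lemma normc_lt z (r : R) : (`|z| < r%:C) = (normc z < r).
Proof. by rewrite normr_normc ltcR. Qed.
Lemma normc_le z (r : R) : (`|z| <= r%:C) = (normc z <= r).
Proof. by rewrite normr_normc lecR. Qed.
Lemma normc_ge0 z : 0 <= normc z.
Proof. by rewrite -lecR -normr_normc normr_ge0. Qed.
Lemma normcX z n : normc (z ^+ n) = normc z ^+ n.
Proof. by elim: n => [|n IH]; rewrite ?expr0 ?normc1 // !exprS normcM IH. Qed.
Lemma normcBC z w : normc (z - w) = normc (w - z).
Proof. by rewrite -normcN opprB. Qed.
Lemma ler_normcB z w : normc z - normc w <= normc (z - w).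
Proof. by rewrite lerBlDr (le_trans _ (le_normcD _ _)) // subrK. Qed.

Lemma normc_poly_of_roots (s : seq R[i]) z :
  normc (poly_of_roots s).[z] = \prod_(w <- s) normc (z - w).
Proof.
rewrite /poly_of_roots; elim: s => [|a s IH]; first by rewrite !big_nil hornerC normc1.
by rewrite !big_cons hornerM normcM IH !hornerE.
Qed.

(** Balls of [R[i]] have radii in [R[i]]; a positive radius there is real, so real radii suffice. *)
Lemma nbhs_normcP z (A : set R[i]) :
  nbhs z A <-> exists e : R, 0 < e /\ forall w, normc (w - z) < e -> A w.
Proof.
rewrite (_ : nbhs z A = @nbhs R[i]^o R[i]^o z A) // -nbhs_ballE; split.
- case=> e e0 sub; exists (complex.Re e).
  have er : e = (complex.Re e)%:C by rewrite RRe_real // gtr0_real.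
  split; first by rewrite -ltcR -er.
  by move=> w h; apply: sub; rewrite /ball /= er normc_lt normcBC.
- case=> e [e0 sub]; exists e%:C; first by rewrite /= ltcR.
  by move=> w; rewrite /ball /= normc_lt normcBC => /sub.
Qed.

Lemma continuous_normc : continuous (@normc R : R[i] -> R).
Proof.
move=> z B /(@nbhs_ballP _ R) [e /= e0 sub]; apply/nbhs_normcP.
exists e; split => // w h; apply: sub; rewrite /ball /= ltr_norml.
have := ler_normcB z w; have := ler_normcB w z.
by rewrite (normcBC z w); move=> h1 h2; apply/andP; split; lra.
Qed.

Lemma continuous_poly (p : {poly R[i]}) : continuous (fun z : R[i] => p.[z]).
Proof.
exact: (@continuous_horner_num R[i] p).
Qed.

Lemma continuous_normc_poly (p : {poly R[i]}) :
  continuous (fun z : R[i] => normc p.[z] : R).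
Proof.
by move=> z; apply: (@continuous_comp _ _ _ (fun z : R[i] => p.[z]) (@normc R));
  [exact: continuous_poly|exact: continuous_normc].
Qed.

Lemma normc_le_ReIm (a b : R) : normc (a +i* b) <= `|a| + `|b|.
Proof.
rewrite /normc -[leRHS]ger0_norm ?addr_ge0 // -sqrtr_sqr ler_sqrt ?sqr_ge0 //.
by rewrite sqrrD !real_normK ?num_real // lerD2r lerDl mulrn_wge0 ?mulr_ge0.
Qed.

Lemma normr_Re_le z : `|complex.Re z| <= normc z.
Proof. by rewrite -lecR -normr_normc normc_ge_Re. Qed.

Lemma normr_Im_le z : `|complex.Im z| <= normc z.
Proof.
case: z => a b; rewrite /= -sqrtr_sqr ler_sqrt ?addr_ge0 ?sqr_ge0 //.
by rewrite lerDr sqr_ge0.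
Qed.

(** Heine-Borel: the set is closed inside the continuous image of a compact square. *)
Lemma closed_bounded_compact (A : set R[i]) (r : R) :
  closed A -> (forall z, A z -> normc z <= r) -> compact A.
Proof.
move=> cA bA.
pose f (p : R * R) : R[i] := p.1 +i* p.2.
have cf : continuous f.
  move=> p B /nbhs_normcP [e [e0 sub]].
  have e2 : 0 < e / 2 by lra.
  exists (ball p.1 (e / 2), ball p.2 (e / 2)) => /=.
    by split; apply: nbhsx_ballx.
  case: p sub => c d sub [a b] /= [ha hb]; apply: sub; rewrite /f.
  rewrite -[_ - _]/((a - c) +i* (b - d)) (le_lt_trans (normc_le_ReIm _ _)) //.
  by move: ha hb; rewrite /ball /= distrC (distrC d); lra.
have cI : compact `[- r, r] by exact: segment_compact.
have := continuous_compact (continuous_subspaceT cf) (compact_setX cI cI).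
move/(subclosed_compact cA); apply => z Az; exists (complex.Re z, complex.Im z).
  by split; rewrite /= in_itv /= -ler_norml (le_trans _ (bA _ Az)) ?normr_Re_le ?normr_Im_le.
by case: z Az.
Qed.

Lemma compact_closedC (K : set R[i]) : compact K -> closed K.
Proof. by apply: (@compact_closed R[i]); exact: (@norm_hausdorff _ R[i]^o). Qed.

Lemma compact_boundedC (K : set R[i]) : compact K ->
  exists2 r : R, 0 < r & forall z, K z -> normc z < r.
Proof.
move=> cK; have [->|K0] := eqVneq K set0; first by exists 1.
have /set0P {}K0 := K0.
have [c _ h] := compact_EVT_max K0 cK (continuous_subspaceT continuous_normc).
exists (normc c + 1); first by have := normc_ge0 c; lra.
by move=> z Kz; have := h z (mem_set Kz); lra.
Qed.

Lemma closed_dist (K : set R[i]) w : closed K -> ~ K w ->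
  exists2 r : R, 0 < r & forall z, K z -> r <= normc (z - w).
Proof.
move=> cK nK; have oK := closed_openC cK.
have := open_nbhs_nbhs (conj oK nK : open_nbhs w (~` K)).
move/nbhs_normcP => [r [r0 h]]; exists r => // z Kz.
by rewrite leNgt; apply/negP => /h.
Qed.

End ComplexModulus.

(** * Bounding the zeros of the derivative, globally and near a point *)

Section LocalCount.
Variable R : realType.
Implicit Types (z w : R[i]) (K : set R[i]) (p : {poly R[i]}).

(* [G / (X - w)^N] equals 1 at infinity and is less than [th] on [K]; the slack
   [d] makes the condition visibly open in [w]. *)
Definition pole_separated K w := exists (G : {poly R[i]}) (N : nat) (th d : R),
  [/\ G \is monic, size G = N.+1, 0 < th < 1, 0 < d &
      forall z, K z -> d < normc (z - w) /\
                       normc G.[z] < th * (normc (z - w) - d) ^+ N].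

Lemma expr_lt_eps (x e : R) : 0 <= x < 1 -> 0 < e -> exists n, x ^+ n < e.
Proof.
move=> /andP[x0 x1] e0.
have /cvgrPdist_lt/(_ e e0) [n _ h] : x ^+ n @[n --> \oo] --> 0.
  by apply: cvg_expr; rewrite ger0_norm.
by exists n; have := h n (leqnn n); rewrite sub0r normrN ger0_norm ?exprn_ge0.
Qed.

Lemma prodr_const_seq (I : Type) (s : seq I) (x : R) :
  \prod_(i <- s) x = x ^+ size s.
Proof. by rewrite big_const_seq count_predT iter_mulr_1. Qed.

Lemma rootsCE p : p = lead_coef p *: poly_of_roots (rootsC p).
Proof. by rewrite /rootsC; case: closed_field_poly_normal. Qed.

Lemma mem_rootsC p z : p != 0 -> (z \in rootsC p) = root p z.
Proof.
move=> p0; rewrite [in RHS](rootsCE p) rootZ ?lead_coef_eq0 //.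
by rewrite root_prod_XsubC.
Qed.

Lemma poly_of_roots_filter (a : pred R[i]) s :
  poly_of_roots (seq.filter a s ++ seq.filter (predC a) s) = poly_of_roots s.
Proof. by apply: perm_big; rewrite perm_filterC. Qed.

(** Carries [deriv_factor_excluded] over to a nonconstant [p] with any leading coefficient, which
    does not affect divisibility of the derivative. *)
Lemma deriv_roots_factor p s1 s2 t G : (1 < size p)%N ->
  poly_of_roots (s1 ++ s2) = poly_of_roots (rootsC p) ->
  poly_of_roots t %| p^`() ->
  G \is monic -> (size G + size s2 = (size t).+1)%N ->
  ~ {in s1, forall z, normc (G * poly_of_roots s2).[z] < normc (poly_of_roots t).[z]}.
Proof.
move=> sp pE tp mG sG h.
have p0 : p != 0 by apply: contraTneq sp => ->; rewrite size_poly0.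
have n0 : (0 < size s1 + size s2)%N.
  rewrite -size_cat -ltnS -size_poly_of_roots pE -(@size_scale _ (lead_coef p)) ?lead_coef_eq0 //.
  by rewrite -rootsCE.
apply: (@deriv_factor_excluded _ s1 s2 t G) => //; last first.
  by move=> z /h; rewrite -ltcR -!normr_normc.
by move: tp; rewrite {1}(rootsCE p) derivZ dvdpZr ?lead_coef_eq0 // pE.
Qed.

(** If [2 * r <= |w|], each zero [z] of [p] has [|z| < r < |z - w|], which is excluded with D = X -
    w and H = X. *)
Lemma deriv_root_bound p (r : R) w : (1 < size p)%N ->
  (forall z, root p z -> normc z < r) ->
  root p^`() w -> normc w < 2 * r.
Proof.
move=> sp hr rw; rewrite ltNge; apply/negP => le.
have p0 : p != 0 by apply: contraTneq sp => ->; rewrite size_poly0.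
apply: (@deriv_roots_factor p (rootsC p) [::] [:: w] 'X) => //.
- by rewrite cats0.
- by rewrite /poly_of_roots big_seq1 dvdp_XsubCl.
- exact: monicX.
- by rewrite size_polyX.
move=> z; rewrite mem_rootsC // => /hr zr.
rewrite /poly_of_roots big_nil big_seq1 mulr1 !hornerE.
by have := ler_normcB w z; rewrite (normcBC w); lra.
Qed.

Lemma local_count_bound K (q : nat -> {poly R[i]}) (r : R) (k0 : nat) w0 :
  0 < r ->
  (forall k, (k0 <= k)%N -> (1 < size (q k))%N /\
     forall z, root (q k) z -> normc z < r) ->
  (forall L : set R[i], closed L -> L `&` K = set0 ->
     exists M : nat, forall k, (k0 <= k)%N -> (nzeros_in L (q k) <= M)%N) ->
  pole_separated K w0 ->
  exists d : R, 0 < d /\ exists M : nat, forall k, (k0 <= k)%N ->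
    (nzeros_in [set w : R[i] | normc (w - w0) < d]%R (q k)^`() <= M)%N.
Proof.
move=> r0 hq hL [G [N [th [d [mG sG /andP[th0 th1] d0 hK]]]]].
(* The separation inequality holds on an open set containing [K]; its complement holds at most [M]
   zeros of each [q k]. *)
pose O := [set z : R[i] | d < normc (z - w0) /\
                   normc G.[z] < th * (normc (z - w0) - d) ^+ N].
have cd : continuous (fun z : R[i] => normc (z - w0) : R).
  have -> : (fun z : R[i] => normc (z - w0)) = (fun z => normc ('X - w0%:P).[z]).
    by apply/funext => z; rewrite !hornerE.
  exact: continuous_normc_poly.
have cdd : continuous (fun z : R[i] => normc (z - w0) - d : R).
  move=> z; apply: (@continuousB R R^o R[i] (fun z => normc (z - w0)) (fun=> d)).
    exact: cd.
  exact: cst_continuous.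
have cG : continuous (fun z : R[i] => th * (normc (z - w0) - d) ^+ N - normc G.[z] : R).
  move=> z; apply: (@continuousB R R^o R[i]
    (fun z => th * (normc (z - w0) - d) ^+ N) (fun z => normc G.[z])).
    apply: (@continuousM R R[i] (fun=> th) (fun z => (normc (z - w0) - d) ^+ N)).
      exact: cst_continuous.
    apply: (@continuous_comp _ _ _ (fun z : R[i] => normc (z - w0) - d) (fun x : R => x ^+ N)).
      exact: cdd.
    exact: exprn_continuous.
  exact: continuous_normc_poly.
have oO : open O.
  rewrite (_ : O = (fun z : R[i] => normc (z - w0) - d) @^-1` [set x | 0 < x] `&`
      (fun z : R[i] => th * (normc (z - w0) - d) ^+ N - normc G.[z]) @^-1` [set x | 0 < x]).
    by apply: openI; apply: open_comp; try exact: open_gt; move=> z _; [exact: cdd|exact: cG].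
  by apply/seteqP; split => z /=; rewrite !subr_gt0.
have [] := hL (~` O) (open_closedC oO).
  by rewrite -subset0 => z [/= nO /hK].
move=> M hM.
(* Zeros [z], [w] of [q k] satisfy [|z - w| < 2r], and below [e > d / 2], so [|z - w| <= C * e]. The
   summand 1 ensures [1 <= C], hence [C ^+ size s2 <= C ^+ M]. *)
pose C := 4 * r / d + 1.
have C1 : 1 <= C by rewrite /C lerDr divr_ge0 ?ltW // mulr_gt0.
have CM0 : 0 < C ^+ M by rewrite exprn_gt0 // (lt_le_trans _ C1).
(* The gain [th ^+ a] from [G ^+ a] outweighs the loss [C ^+ M] from the zeros outside [O]. *)
have [a ha] : exists a, th ^+ a < (C ^+ M)^-1.
  by apply: expr_lt_eps; rewrite ?invr_gt0 // (ltW th0).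
exists (d / 2); split; first by rewrite divr_gt0.
exists (a * N + M)%N => k kk; have [sq rq] := hq k kk.
have q0 : q k != 0 by apply: contraTneq sq => ->; rewrite size_poly0.
rewrite leqNgt; apply/negP => big.
pose s := rootsC (q k).
pose s1 := [seq z <- s | ~~ `[< (~` O) z >]].
pose s2 := [seq z <- s | predC (fun z => ~~ `[< (~` O) z >]) z].
have s2M : (size s2 <= M)%N.
  rewrite (leq_trans _ (hM k kk)) // /nzeros_in size_filter leq_eqVlt; apply/orP; left.
  by apply/eqP; apply: eq_count => z /=; rewrite negbK.
pose t' := [seq w <- rootsC (q k)^`() | `[< normc (w - w0) < d / 2 >]].
(* Just enough zeros of the derivative near [w0] for D to have the degree of [G ^+ a] times the
   polynomial of [s2]. *)
pose t := take (a * N + size s2) t'.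
have st : size t = (a * N + size s2)%N.
  rewrite size_takel // [leqRHS]size_filter; apply: leq_trans (ltnW big).
  by rewrite leq_add2l.
apply: (@deriv_roots_factor (q k) s1 s2 t (G ^+ a)) => //.
- exact: poly_of_roots_filter.
- rewrite {1}(rootsCE (q k)^`()) -mul_polyC dvdp_mull // -/t'.
  rewrite -(poly_of_roots_filter (fun w => `[< normc (w - w0) < d / 2 >])) -/t'.
  rewrite -[t'](cat_take_drop (a * N + size s2)%N).
  by rewrite /poly_of_roots -catA big_cat dvdp_mulr.
- exact: monic_exp.
- rewrite st -addSn; congr (_ + _)%N.
  have := size_exp G a; rewrite sG /= mulnC => <-; rewrite prednK // size_poly_gt0.
  by rewrite monic_neq0 // monic_exp.
move=> z; rewrite mem_filter => /andP[/asboolPn/contrapT [zd Gz] zs].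
have zr : normc z < r by apply: rq; rewrite -mem_rootsC.
(* A lower bound for the distance from [z] to every entry of [t], and an upper bound for the base
   [|z - w0| - d] in [Gz]. *)
pose e := normc (z - w0) - d / 2.
have ed : d / 2 < e by rewrite /e; lra.
have e0 : 0 < e by lra.
have lower : e ^+ (a * N + size s2) <= normc (poly_of_roots t).[z].
  rewrite normc_poly_of_roots -st -prodr_const_seq !big_seq.
  apply: ler_prod => w wt; rewrite (ltW e0) /=.
  have : w \in t' by exact: mem_take wt.
  rewrite mem_filter => /andP[/asboolP wd _].
  have := ler_normcB (z - w0) (w - w0).
  by rewrite (_ : z - w0 - (w - w0) = z - w) /e; [lra|ring].
apply: lt_le_trans lower.
rewrite hornerM normcM horner_exp normcX normc_poly_of_roots.
have up1 : normc G.[z] ^+ a <= (th * e ^+ N) ^+ a.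
  have GeN : normc G.[z] <= th * e ^+ N.
    rewrite (le_trans (ltW Gz)) // ler_pM2l //.
    by apply: lerXn2r; rewrite ?nnegrE ?subr_ge0 ?(ltW e0) ?(ltW zd) // /e; lra.
  by apply: lerXn2r; rewrite ?nnegrE ?normc_ge0 // (le_trans (normc_ge0 _) GeN).
have up2 : \prod_(w <- s2) normc (z - w) <= (C * e) ^+ size s2.
  rewrite -prodr_const_seq !big_seq; apply: ler_prod => w.
  rewrite mem_filter => /andP[_]; rewrite mem_rootsC // => /rq wr.
  rewrite normc_ge0 /= (le_trans (le_normcD _ _)) // normcN.
  have : 2 * r <= 4 * r / d * e by rewrite mulrAC ler_pdivlMr // -mulrA [_ * e]mulrC; nra.
  rewrite /C mulrDl; lra.
apply: le_lt_trans (ler_pM _ _ up1 up2) _.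
- by rewrite exprn_ge0 ?normc_ge0.
- by rewrite prodr_ge0 // => w _; rewrite normc_ge0.
rewrite !exprMn exprD mulnC exprM mulrACA gtr_pMl ?mulr_gt0 ?exprn_gt0 //.
rewrite -ltr_pdivlMr ?exprn_gt0 ?(lt_le_trans _ C1) // mul1r (lt_le_trans ha) //.
by rewrite lef_pV2 ?posrE ?exprn_gt0 ?(lt_le_trans _ C1) // ler_weXn2l.
Qed.
End LocalCount.

(** * Roots of unity and discrete mean values *)

Lemma exists_prim_root (F : numClosedFieldType) n : (0 < n)%N ->
  exists w : F, n.-primitive_root w.
Proof.
move=> n0; have [r rE] := closed_field_poly_normal ('X^n - 1 : {poly F}).
rewrite lead_coefDl ?size_polyXn ?size_polyN ?size_poly1 // lead_coefXn scale1r in rE.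
have ur : uniq r.
  rewrite -(separable_prod_XsubC r) -rE separable_Xn_sub_1 //.
  by rewrite pnatr_eq0 -lt0n.
have sr : size r = n.
  by apply: succn_inj; rewrite -(size_prod_XsubC _ id) -rE size_XnsubC.
have ar : all n.-unity_root r.
  by apply/allP => x xr; rewrite /root_of_unity rE root_prod_XsubC.
have /hasP [w _ pw] := has_prim_root n0 ar ur (eq_leq (esym sr)).
by exists w.
Qed.

(** Mean value property on a regular polygon: [p.[z + h * x]] has degree below [n] in [x], and the
    [i]th powers of the [n]th roots of unity sum to 0 for [0 < i < n]. *)
Lemma sum_horner_prim_root (F : fieldType) n (w : F) (p : {poly F}) (z h : F) :
  n.-primitive_root w -> (size p <= n)%N ->
  \sum_(j < n) p.[z + h * w ^+ j] = p.[z] *+ n.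
Proof.
move=> pw sp; have n0 := prim_order_gt0 pw.
pose q := p \Po (z%:P + h *: 'X).
have sq : (size q <= n)%N.
  rewrite (leq_trans (size_comp_poly_leq _ _)) //.
  have s2 : ((size (z%:P + h *: 'X)%R).-1 <= 1)%N.
    rewrite -subn1 leq_subLR (leq_trans (size_polyD _ _)) //.
    rewrite geq_max (leq_trans (size_polyC_leq1 _)) //=.
    by rewrite (leq_trans (size_scale_leq _ _)) // size_polyX.
  case: (size p) sp => [|k] //= sp.
  by rewrite (leq_ltn_trans _ sp) // (leq_trans (leq_mul (leqnn k) s2)) // muln1.
have qE x : p.[z + h * x] = q.[x] by rewrite horner_comp !hornerE.
under eq_bigr do rewrite qE (horner_coef_wide _ sq).
rewrite exchange_big /= (bigD1 (Ordinal n0)) //= [X in _ + X]big1 ?addr0.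
  under eq_bigr do rewrite /= expr0 mulr1.
  rewrite sumr_const card_ord; congr (_ *+ _).
  by rewrite -horner_coef0 -qE mulr0 addr0.
move=> i i0; rewrite -mulr_sumr.
under eq_bigr do rewrite exprAC.
suff -> : \sum_(j < n) (w ^+ i) ^+ j = 0 by rewrite mulr0.
have wi : w ^+ i - 1 != 0.
  rewrite subr_eq0 -(expr0 w) (eq_prim_root_expr pw) eqn_mod_dvd //= subn0.
  by rewrite gtnNdvd // lt0n.
apply: (mulfI wi); rewrite mulr0 -subrX1 exprAC (prim_expr_order pw) expr1n.
exact: subrr.
Qed.

(** * A maximum principle from discrete means *)

Section PoleSeparation.
Variable R : realType.
Implicit Types (z w : R[i]) (K : set R[i]) (p : {poly R[i]}).

(** Variance identity: [c] is the mean of the [a j], so the cross terms sum to 0. *)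
Lemma sum_normc_sqr n (a : 'I_n -> R[i]) (c : R[i]) :
  \sum_j a j = c *+ n ->
  \sum_j normc (a j) ^+ 2 = \sum_j (normc c ^+ 2 + normc (a j - c) ^+ 2).
Proof.
move=> aE.
have sE (x : R[i]) : normc x ^+ 2 = complex.Re x ^+ 2 + complex.Im x ^+ 2.
  by case: x => u v /=; rewrite sqr_sqrtr // addr_ge0 ?sqr_ge0.
have ReD (I : finType) (f : I -> R[i]) : complex.Re (\sum_j f j) = \sum_j complex.Re (f j).
  by apply: (big_morph (@complex.Re R)) => // -[? ?] [? ?].
have ImD (I : finType) (f : I -> R[i]) : complex.Im (\sum_j f j) = \sum_j complex.Im (f j).
  by apply: (big_morph (@complex.Im R)) => // -[? ?] [? ?].
have cE : c *+ n = \sum_(j < n) c by rewrite sumr_const card_ord.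
have re : \sum_j complex.Re (a j) = \sum_(j < n) complex.Re c by rewrite -!ReD aE cE.
have im : \sum_j complex.Im (a j) = \sum_(j < n) complex.Im c by rewrite -!ImD aE cE.
apply/eqP; rewrite -subr_eq0 -sumrB.
rewrite (eq_bigr (fun j => 2 * complex.Re c * (complex.Re (a j) - complex.Re c)
   + 2 * complex.Im c * (complex.Im (a j) - complex.Im c))); last first.
  by move=> j _; rewrite !sE; case: (a j) => [u v]; clear; case: c => [x y] /=; ring.
by rewrite big_split /= -!mulr_sumr !sumrB re im !subrr !mulr0 addr0.
Qed.

(* [|p|^2 + e |z|^2] is strictly subharmonic, so it has no local maximum. *)
Lemma no_local_max p (e r : R) z : 0 < e -> 0 < r ->
  exists2 w, normc (w - z) < r &
    normc p.[z] ^+ 2 + e * normc z ^+ 2 < normc p.[w] ^+ 2 + e * normc w ^+ 2.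
Proof.
move=> e0 r0; apply: contrapT => nex.
(* Large enough for the mean value property of both [p] and ['X], the latter of size 2. *)
pose n := (size p).+2.
have [u pu] := @exists_prim_root R[i] n isT.
have u1 j : normc (u ^+ j) = 1.
  rewrite normcX; have /eqP : normc u ^+ n = 1 by rewrite -normcX prim_expr_order ?normc1.
  by rewrite pexpr_eq1 ?normc_ge0 // => /eqP ->; rewrite expr1n.
pose h : R[i] := (r / 2)%:C.
have nh : normc h = r / 2 by rewrite /= expr0n /= addr0 sqrtr_sqr gtr0_norm // divr_gt0.
pose b j := z + h * u ^+ j.
have bz j : normc (b j - z) = r / 2 by rewrite /b addrC addKr normcM u1 nh mulr1.
have S1 := sum_horner_prim_root z h pu (leqW (leqW (leqnn (size p)))).
have S2 : \sum_(j < n) b j = z *+ n.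
  have := @sum_horner_prim_root _ n u 'X z h pu; rewrite size_polyX hornerX => <- //.
  by apply: eq_bigr => j _; rewrite hornerX.
have := sum_normc_sqr S1; have := sum_normc_sqr S2.
move=> E2 E1.
have le : \sum_(j < n) (normc p.[b j] ^+ 2 + e * normc (b j) ^+ 2) <=
          \sum_(j < n) (normc p.[z] ^+ 2 + e * normc z ^+ 2).
  apply: ler_sum => j _; rewrite leNgt; apply/negP => lt; apply: nex.
  by exists (b j) => //; rewrite bz; lra.
(* By [E1] and [E2] each vertex contributes an excess of at least [e * (r / 2) ^+ 2] to the left
   side. *)
move: le; rewrite big_split /= -mulr_sumr E1 E2 mulr_sumr -big_split /= leNgt => /negP; apply.
apply: ltr_sum; first by apply/hasP; exists ord0; rewrite ?mem_index_enum.
move=> j _; rewrite bz mulrDr.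
have : 0 < e * (r / 2) ^+ 2 by rewrite mulr_gt0 // exprn_gt0 // divr_gt0.
have := sqr_ge0 (normc (p.[b j] - p.[z])).
rewrite -/(b j); lra.
Qed.

(** * Pole-separated points and the polynomial hull *)

Lemma pole_separated_nbhs K w : pole_separated K w ->
  exists2 e : R, 0 < e & forall w', normc (w' - w) < e -> pole_separated K w'.
Proof.
case=> [G [N [th [d [mG sG th01 d0 hK]]]]].
(* Half of the slack absorbs the shift: [|z - w'| - d / 2 >= |z - w| - d]. *)
exists (d / 2); first by rewrite divr_gt0.
move=> w' ww'; exists G, N, th, (d / 2); split => //; first by rewrite divr_gt0.
move=> z Kz; have [zd Gz] := hK z Kz.
have : normc (z - w) - normc (w' - w) <= normc (z - w').
  by rewrite (le_trans (ler_normcB _ _)) // opprB addrA subrK.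
move=> tri; split; first lra.
rewrite (lt_le_trans Gz) // ler_pM2l; last by case/andP: th01.
by apply: lerXn2r; rewrite ?nnegrE; lra.
Qed.

Lemma pole_separated_far K w (r : R) : 0 < r -> (forall z, K z -> normc z < r) ->
  4 * r <= normc w -> pole_separated K w.
Proof.
(* On [K], [|z - w| > 3r], so [(|z - w| - r) / 2 > r > |z|]. *)
move=> r0 hK hw; exists 'X, 1%N, (1 / 2), r; split => //.
- exact: monicX.
- by rewrite size_polyX.
- lra.
move=> z Kz; have := hK z Kz; have := ler_normcB w z; rewrite (normcBC w) hornerX expr1.
by move=> h1 h2; split; lra.
Qed.

Lemma bernoulli_sub (x : R) n : 0 <= x <= 1 -> 1 - n%:R * x <= (1 - x) ^+ n.
Proof.
move=> /andP[x0 x1]; elim: n => [|n IH]; first by rewrite mul0r subr0 expr0.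
rewrite exprS -natr1 mulrDl.
have : (1 - x) * (1 - n%:R * x) <= (1 - x) * (1 - x) ^+ n by rewrite ler_wpM2l // subr_ge0.
apply: le_trans.
have : 0 <= n%:R * x * x by rewrite !mulr_ge0.
by nra.
Qed.

(** By [bernoulli_sub] the product is at most [(1 - y^2)^n]. *)
Lemma bernoulli_add (y : R) n : 0 <= y <= 1 -> (1 + y) ^+ n * (1 - n%:R * y) <= 1.
Proof.
move=> y01; have /andP[y0 y1] := y01.
rewrite (le_trans (ler_wpM2l _ (bernoulli_sub n y01))) ?exprn_ge0 ?addr_ge0 //.
rewrite -exprMn exprn_ile1 //; nra.
Qed.

(* Moves the pole of [G / (X - w')^N] to the nearby point [w], by truncating
   the expansion of [1 / (X - w')] in powers of [1 / (X - w)]. *)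
Lemma pole_separated_close K w w' (r : R) : 0 < r ->
  (forall z, K z -> 2 * r <= normc (z - w)) -> normc (w' - w) < r ->
  pole_separated K w' -> pole_separated K w.
Proof.
move=> r0 hr ww' [G [N [th [d' [mG sG /andP[th0 th1] d'0 hK]]]]].
(* Three factors [1 - eta] are spent: on the new [th], on the truncation error and on the new slack.
   They fit because [1 - 4 * eta < (1 - eta)^3]. *)
pose eta := (1 - th) / 4.
have eta0 : 0 < eta by rewrite divr_gt0 // subr_gt0.
have N1 : 0 < N.+1%:R :> R by rewrite ltr0n.
(* Since [|c| < r <= |z - w| / 2] on [K], truncating at order [m] costs a relative error [y], and
   [N * y <= eta]. *)
have [m hm] : exists m, (1 / 2 : R) ^+ m < eta / N.+1%:R.
  by apply: expr_lt_eps; [lra|rewrite divr_gt0].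
set y := (1 / 2 : R) ^+ m in hm.
have y0 : 0 <= y by rewrite exprn_ge0 //; lra.
have y1 : y <= 1 by rewrite exprn_ile1 //; lra.
have Ny : N%:R * y <= eta.
  by move: hm; rewrite ltr_pdivlMr // -natr1; lra.
have m0 : (0 < m)%N.
  rewrite lt0n; apply/eqP => m0; move: hm; rewrite /y m0 expr0 ltr_pdivlMr // mul1r.
  have : 1 <= N.+1%:R :> R by rewrite ler1n.
  by rewrite /eta; lra.
pose a := ('X - w%:P : {poly R[i]}); pose c := w' - w.
(* [Q] is the quotient of [a ^+ m - c ^+ m] by [a - c = X - w'], so [Q / a ^+ m] approximates
   [1 / (X - w')]. *)
pose Q := \sum_(i < m) a ^+ (m.-1 - i) * c%:P ^+ i.
have QE : ('X - w'%:P) * Q = a ^+ m - (c ^+ m)%:P.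
  rewrite polyC_exp subrXX; congr (_ * _).
  by rewrite /a /c polyCB opprB addrA subrK.
have sa : size (a ^+ m) = m.+1.
  by rewrite size_exp_XsubC.
have sac : (size (- (c ^+ m)%:P) < size (a ^+ m)%R)%N.
  by rewrite size_polyN sa ltnS (leq_trans (size_polyC_leq1 _)).
have mQ : Q \is monic.
  rewrite -(monicMr _ (monicXsubC w')) mulrC QE monicE lead_coefDl //.
  by apply/eqP/monicP/monic_exp/monicXsubC.
have sQ : size Q = m.
  have : size (('X - w'%:P) * Q) = m.+1 by rewrite QE size_polyDl.
  by rewrite size_monicM ?monicXsubC ?monic_neq0 // size_XsubC add2n /= => -[].
pose mN := (m * N)%N.
have mN1 : 0 < mN.+1%:R :> R by rewrite ltr0n.
(* Small enough that [(1 - x) ^+ mN >= 1 - eta]; as [r <= D] below, the slack [r * x] shrinks [D] by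
   at most the factor [1 - x]. *)
pose x := eta / mN.+1%:R.
have x0 : 0 < x by rewrite divr_gt0.
have xm : mN%:R * x <= eta.
  have : mN.+1%:R * x = eta by rewrite mulrC divfK // lt0r_neq0.
  by rewrite -natr1; lra.
have x1 : x <= 1.
  have : mN.+1%:R * x = eta by rewrite mulrC divfK // lt0r_neq0.
  have : 1 <= mN.+1%:R :> R by rewrite ler1n.
  by rewrite /eta; nra.
exists (G * Q ^+ N), mN, (1 - eta), (r * x); split => //.
- by rewrite monicMl // monic_exp.
- rewrite size_monicM ?monic_neq0 ?monic_exp // sG addSn /=.
  have := size_exp Q N; rewrite sQ => E.
  have : (0 < size (Q ^+ N)%R)%N by rewrite size_poly_gt0 monic_neq0 ?monic_exp.
  rewrite /mN; case: (size _) E => // k /= -> _.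
  by case: (m) m0 => // l _; rewrite addnS mulSn.
- by rewrite /eta; lra.
- exact: mulr_gt0.
move=> z Kz; have [zd Gz] := hK z Kz; have zr := hr z Kz.
set D := normc (z - w) in zr *.
have Dr : r * x <= D * x by rewrite ler_wpM2r //; lra.
split; first by nra.
have cD : normc c ^+ m <= D ^+ m * y.
  rewrite /y -exprMn; apply: lerXn2r; rewrite ?nnegrE ?normc_ge0 //; first lra.
  by rewrite /c; lra.
have QN : normc (z - w') * normc Q.[z] <= D ^+ m * (1 + y).
  rewrite -normcM.
  have -> : (z - w') * Q.[z] = (z - w) ^+ m - c ^+ m.
    by have := congr1 (horner^~ z) QE; rewrite hornerM !hornerE.
  by rewrite (le_trans (le_normcD _ _)) // normcN !normcX -/D mulrDr mulr1; lra.
rewrite hornerM normcM horner_exp normcX.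
have step1 : normc G.[z] * normc Q.[z] ^+ N <= th * (D ^+ m * (1 + y)) ^+ N.
  have : normc G.[z] <= th * normc (z - w') ^+ N.
    rewrite (le_trans (ltW Gz)) // ler_pM2l //.
    by apply: lerXn2r; rewrite ?nnegrE ?normc_ge0 //; lra.
  move=> h; rewrite (le_trans (ler_wpM2r _ h)) ?exprn_ge0 ?normc_ge0 //.
  rewrite -mulrA ler_pM2l // -exprMn.
  by apply: lerXn2r; rewrite ?nnegrE ?mulr_ge0 ?normc_ge0 ?exprn_ge0 //; lra.
apply: (le_lt_trans step1).
have D0 : 0 < D ^+ mN by rewrite exprn_gt0 //; lra.
have step2 : (D * (1 - x)) ^+ mN <= (D - r * x) ^+ mN.
  by apply: lerXn2r; rewrite ?nnegrE; nra.
have eta1 : 0 < 1 - eta by rewrite /eta; lra.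
apply: (@lt_le_trans _ _ ((1 - eta) * (D * (1 - x)) ^+ mN)); last by rewrite ler_pM2l.
rewrite !exprMn -exprM -/mN mulrCA [ltRHS]mulrCA ltr_pM2l //.
have B1 : (1 + y) ^+ N * (1 - eta) <= 1.
  apply: le_trans (bernoulli_add N (_ : 0 <= y <= 1)); last by rewrite y0 y1.
  by rewrite ler_wpM2l ?exprn_ge0 //; lra.
have B2 : 1 - eta <= (1 - x) ^+ mN.
  by rewrite (le_trans _ (bernoulli_sub _ _)) ?x1 ?(ltW x0) //; lra.
rewrite -(ltr_pM2r eta1) -mulrA (le_lt_trans (ler_wpM2l (ltW th0) B1)) // mulr1.
have -> : th = 1 - 4 * eta by rewrite /eta; lra.
apply: (@lt_le_trans _ _ ((1 - eta) * (1 - eta) * (1 - eta))); first by nra.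
by rewrite ler_pM2r // ler_pM2l.
Qed.

(** At a maximum over [A] of [|p|^2 + e |z|^2] outside [K], a larger value occurs nearby at a
    separated point, and [pole_separated_close] makes the maximum point separated too. So the
    maximum lies on [K], where a suitable [e] keeps it below the value at [w]. *)
Lemma not_pole_separated_hull K w : K !=set0 -> compact K ->
  ~ pole_separated K w -> poly_hull K w.
Proof.
move=> [z0 Kz0] cK nw p M hp; rewrite normc_le leNgt; apply/negP => lt.
have {}hp z : K z -> normc p.[z] <= M by move=> /hp; rewrite normc_le.
have M0 : 0 <= M by rewrite (le_trans (normc_ge0 _) (hp _ Kz0)).
have [r r0 Kr] := compact_boundedC cK.
pose A := [set z : R[i] | ~ pole_separated K z].
have cA : compact A.
  apply: (@closed_bounded_compact _ _ (4 * r)).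
    rewrite -openC openE => z /=; rewrite /A /setC /= => /contrapT /pole_separated_nbhs [e e0 h].
    by apply/nbhs_normcP; exists e; split => // w' /h h' /=.
  move=> z Az; rewrite leNgt; apply/negP => /ltW h.
  by apply: Az; exact: pole_separated_far h.
(* Chosen so that on [K] the function [phi] is below [M^2 + e (r^2 + 1) = |p.[w]|^2], hence below
   [phi w]. *)
pose e := (normc p.[w] ^+ 2 - M ^+ 2) / (r ^+ 2 + 1).
have r21 : 0 < r ^+ 2 + 1 by rewrite ltr_wpDl ?sqr_ge0.
have e0 : 0 < e by rewrite divr_gt0 // subr_gt0 ltrXn2r ?nnegrE ?normc_ge0.
pose phi (z : R[i]) : R := normc p.[z] ^+ 2 + e * normc z ^+ 2.
have sqc (f : R[i] -> R) : continuous f -> continuous (fun z => f z ^+ 2 : R).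
  move=> cf z; apply: (@continuous_comp _ _ _ f (fun x : R => x ^+ 2)); first exact: cf.
  exact: exprn_continuous.
have cphi : continuous phi.
  move=> z; apply: (@continuousD R R^o R[i] (fun z => normc p.[z] ^+ 2)
    (fun z => e * normc z ^+ 2)).
    by apply: sqc; exact: continuous_normc_poly.
  apply: (@continuousM R R[i] (fun=> e) (fun z => normc z ^+ 2)).
    exact: cst_continuous.
  by apply: sqc; exact: continuous_normc.
have [c /set_mem Ac maxc] := compact_EVT_max (ex_intro _ w nw) cA (continuous_subspaceT cphi).
have nKc : ~ K c.
  move=> Kc; have := maxc w (mem_set nw); rewrite leNgt => /negP; apply.
  have : normc p.[c] ^+ 2 <= M ^+ 2 by apply: lerXn2r; rewrite ?nnegrE ?normc_ge0 ?hp.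
  have : e * normc c ^+ 2 < e * (r ^+ 2 + 1).
    rewrite ltr_pM2l // ltr_wpDr // -?ltrBlDr.
    by have := Kr c Kc; have := normc_ge0 c; nra.
  have : 0 <= e * normc w ^+ 2 by rewrite mulr_ge0 ?sqr_ge0 // ltW.
  by rewrite /phi [e * (_ + 1)]divfK ?lt0r_neq0 //; lra.
have [d d0 hd] := closed_dist (compact_closedC cK) nKc.
(* [pole_separated_close] asks that [K] be at least twice as far from [c] as the bound on the shift
   of the pole. *)
have d2 : 0 < d / 2 by rewrite divr_gt0.
have [w' w'c lt'] := no_local_max p c e0 d2.
have sw' : pole_separated K w'.
  apply: contrapT => nw'; have := maxc w' (mem_set nw').
  by rewrite leNgt => /negP; apply.
apply: Ac; apply: (pole_separated_close d2 _ w'c sw') => z /hd.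
by rewrite mulrC divfK.
Qed.

(** * Finite covers and passage to the derivative *)

Lemma nzeros_cover (D : seq R[i]) (f : R[i] -> set R[i]) (L : set R[i]) p (g : R[i] -> nat) :
  (forall z, z \in rootsC p -> L z -> exists2 w, w \in D & f w z) ->
  (forall w, w \in D -> (nzeros_in (f w) p <= g w)%N) ->
  (nzeros_in L p <= \sum_(w <- D) g w)%N.
Proof.
move=> cov hg.
apply: (@leq_trans (\sum_(w <- D) nzeros_in (f w) p)%N); last first.
  by rewrite !big_seq; apply: leq_sum => w; exact: hg.
rewrite /nzeros_in; elim: (rootsC p) cov => [|z s IH] cov /=; first by rewrite leq0n.
rewrite big_split /= leq_add //; last first.
  by apply: IH => x xs; apply: cov; rewrite in_cons xs orbT.
case: asboolP => [Lz|_] //; have [w wD fw] := cov z (mem_head _ _) Lz.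
by rewrite (big_rem w) //= asboolT.
Qed.

(** The zeros of the derivative stay in the disk of radius [2 * r]; the part of [L] in the closed
    disk is compact, hence covered by finitely many of the disks from [local_count_bound]. *)
Lemma centers_on_deriv K (q : nat -> {poly R[i]}) :
  K !=set0 -> compact K -> poly_convex K ->
  (exists k1 : nat, forall k, (k1 <= k)%N -> (1 < size (q k))%N) ->
  centers_on K q -> centers_on K (fun k => (q k)^`()).
Proof.
move=> K0 cK pK [k1 hk1] [r [k0 [r0 [hq hL]]]].
have hk k : (maxn k0 k1 <= k)%N -> (1 < size (q k))%N /\
     forall z, root (q k) z -> normc z < r.
  rewrite geq_max => /andP[kk0 kk1]; split; first exact: hk1.
  by move=> z /(hq k kk0).2; rewrite normc_lt.
have hL' (L : set R[i]) : closed L -> L `&` K = set0 ->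
     exists M : nat, forall k, (maxn k0 k1 <= k)%N -> (nzeros_in L (q k) <= M)%N.
  move=> cL LK; have [M hM] := hL L cL LK; exists M => k.
  by rewrite geq_max => /andP[kk0 _]; exact: hM.
have dn0 k : (maxn k0 k1 <= k)%N -> (q k)^`() != 0.
  by move=> /hk[sq _]; rewrite -size_poly_gt0 size_deriv_num; case: (size _) sq => [|[]].
exists (2 * r), (maxn k0 k1); split; first by rewrite mulr_gt0.
split=> [k kk|L cL LK].
  split; first exact: dn0.
  by have [sq rq] := hk k kk; move=> z /(deriv_root_bound sq rq); rewrite normc_lt.
pose A := L `&` [set z : R[i] | normc z <= 2 * r].
have cA : compact A.
  apply: (@closed_bounded_compact _ _ (2 * r)); last by move=> z [].
  apply: closedI => //.
  apply: (@preimage_closed R[i] R (@normc R) [set x | x <= 2 * r]); last exact: closed_le.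
  by move=> z _; exact: continuous_normc.
have loc w : exists dM : R * nat, A w -> 0 < dM.1 /\ forall k, (maxn k0 k1 <= k)%N ->
    (nzeros_in [set z : R[i] | normc (z - w) < dM.1]%R (q k)^`() <= dM.2)%N.
  (* Off [A] the pair is a dummy, present so that [choice] yields a total function. *)
  have [Aw|nAw] := pselect (A w); last by exists (0, 0%N).
  have sw : pole_separated K w.
    apply: contrapT => /(not_pole_separated_hull K0 cK) /pK Kw.
    by have : (L `&` K) w; [split => //; case: Aw|rewrite LK].
  have [d [d0 [M hM]]] := local_count_bound r0 hk hL' sw.
  by exists (d, M) => _.
have {loc} [dM hdM] := choice loc.
pose f w := [set z : R[i] | normc (z - w) < (dM w).1].
have of_ w : open (f w).
  rewrite (_ : f w = (fun z : R[i] => normc ('X - w%:P).[z]) @^-1` [set x | x < (dM w).1]).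
    apply: open_comp; last exact: open_lt.
    by move=> z _; exact: continuous_normc_poly.
  by apply/seteqP; split => z /=; rewrite !hornerE.
have : cover_compact A by rewrite -compact_cover.
case/(_ R[i] A f) => [w _||].
- exact: of_.
- by move=> w Aw; exists w => //; rewrite /f /= subrr normc0; case: (hdM w Aw).
move=> D DA cov; exists (\sum_(w <- finmap.enum_fset D) (dM w).2)%N => k kk.
apply: (@nzeros_cover _ f) => [z|w wD].
  rewrite mem_rootsC ?dn0 // => rz Lz.
  have [sq rq] := hk k kk.
  have Az : A z by split => //=; rewrite ltW // (deriv_root_bound sq rq rz).
  by have [w wD fw] := cov z Az; exists w.
by have [_] := hdM w (set_mem (DA w wD)); apply.
Qed.
End PoleSeparation.

Theorem theoremA (R : realType) (K : set R[i]) (q : nat -> {poly R[i]}) :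
  K !=set0 -> compact K -> poly_convex K ->
  (forall N : nat, exists k1 : nat, forall k, (k1 <= k)%N -> (N <= (size (q k)).-1)%N) ->
  centers_on K q ->
  forall m : nat, (0 < m)%N -> centers_on K (fun k => (q k)^`(m)).
Proof.
move=> K0 cK pK deg cq m _; elim: m => [|m IH]; first by [].
have -> : (fun k => (q k)^`(m.+1)) = (fun k => ((q k)^`(m))^`()).
  by apply/funext => k; rewrite derivnS.
apply: centers_on_deriv => //.
(* Degree at least [m.+1] keeps the [m]th derivative nonconstant. *)
have [k1 hk1] := deg m.+1; exists k1 => k /hk1 h.
by rewrite size_derivn_num ltn_subRL addn1; case: (size _) h.
Qed.
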